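(* Let $d\ge1$. Suppose the following (intersection version of the Kneser–Poulsen conjecture) holds: for every $m\ge 1$, every $r>0$, and all points $x_1,\dots,x_m,y_1,\dots,y_m\in\mathbb{R}^d$ with $\|y_i-y_j\|_2\le\|x_i-x_j\|_2$ for all $i,j\in\{1,\dots,m\}$, one has $$\mathrm{Vol}\Bigl(\bigcap_{i=1}^m B(y_i,r)\Bigr)\ge\mathrm{Vol}\Bigl(\bigcap_{i=1}^m B(x_i,r)\Bigr).$$ Then for every $\mathbb{R}^d$-valued random vector $X$, every contraction $T:\mathbb{R}^d\to\mathbb{R}^d$, every integer $k\ge2$, and $W$ uniformly distributed on the unit ball $B(0,1)$ and independent of $X$, $$h_k(T(X)+W)\le h_k(X+W).$$
   Context: $B(x,r)$ is the open Euclidean ball in $\mathbb{R}^d$ of radius $r$ centered at $x$, and $\mathrm{Vol}$ is Lebesgue measure. A contraction is a $1$-Lipschitz map for the Euclidean norm. For a random vector $Y$ with density $f$ and $\alpha\in(0,1)\cup(1,\infty)$, $h_\alpha(Y)=\frac{1}{1-\alpha}\log\int_{\mathbb{R}^d}f^\alpha$ is the Rényi entropy of order $\alpha$. *)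

(* Defs.v *)
From HB Require Import structures.
From mathcomp Require Import all_boot all_order all_algebra.
From mathcomp Require Import all_classical all_reals all_analysis.
From mathcomp Require Import measurable_realfun.

Set Implicit Arguments.
Unset Strict Implicit.
Unset Printing Implicit Defensive.

Import Order.TTheory GRing.Theory Num.Theory.
Import numFieldNormedType.Exports.

Local Open Scope classical_set_scope.
Local Open Scope ring_scope.

(* The Borel sigma-algebra of R^d, presented as the product sigma-algebra (as
   is done for [n.-tuple T] in MathComp-Analysis); see [measurable_rV_open]. *)
Section measurable_rV.
Context (R : realType) (d : nat).

Definition rV_coord (i : 'I_d) (x : 'rV[R]_d) : R := x ord0 i.

Let rV_set0 : g_sigma_preimage rV_coord set0.
Proof. exact: sigma_algebra0. Qed.

Let rV_setC A : g_sigma_preimage rV_coord A -> g_sigma_preimage rV_coord (~` A).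
Proof. exact: sigma_algebraC. Qed.

Let rV_bigcup (F : _^nat) : (forall i, g_sigma_preimage rV_coord (F i)) ->
  g_sigma_preimage rV_coord (\bigcup_i (F i)).
Proof. exact: sigma_algebra_bigcup. Qed.

HB.instance Definition _ := @isMeasurable.Build default_measure_display
  'rV[R]_d (g_sigma_preimage rV_coord) rV_set0 rV_setC rV_bigcup.

Lemma measurable_rV_coord (i : 'I_d) :
  measurable_fun [set: 'rV[R]_d] (rV_coord i).
Proof.
move=> _ Y mY; rewrite setTI; apply: sub_sigma_algebra => /=.
rewrite -bigcup_seq/=; exists i => /=; first by rewrite mem_index_enum.
by exists Y => //; rewrite setTI.
Qed.

Lemma measurable_fun_rVP d1 (T : measurableType d1) (f : T -> 'rV[R]_d) :
  measurable_fun [set: T] f <->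
  forall i, measurable_fun [set: T] (fun t => f t ord0 i).
Proof.
split=> [mf i|mf].
  exact: (measurableT_comp (measurable_rV_coord i) mf).
suff H : g_sigma_preimage (fun i => rV_coord i \o f) `<=` measurable.
  move: H; rewrite g_sigma_preimage_comp => H _ A mA.
  by apply: H; exists A.
apply: smallest_sub; first exact: sigma_algebra_measurable.
elim/big_ind: _ => [//|A B HA HB|i _]; first by rewrite subUset.
by move=> A [B mB <-]; exact: mf.
Qed.

End measurable_rV.

Section measurable_rV_open.
Context (R : realType) (d : nat).
Local Notation V := 'rV[R]_d.

Let coord_open (i : 'I_d) (A : set R) : open A ->
  open ((@rV_coord R d i) @^-1` A).
Proof.
move=> oA; apply: open_comp => // x _; exact: coord_continuous.
Qed.

Lemma measurable_rV_open :
  (measurable : set (set V)) = <<s [set A : set V | open A] >>.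
Proof.
rewrite eqEsubset; split.
- apply: smallest_sub; first exact: smallest_sigma_algebra.
  elim/big_ind: _ => [//|A B HA HB|i _]; first by rewrite subUset.
  have mc : measurable_fun setT
     (@rV_coord R d i : g_sigma_algebraType [set A : set V | open A] -> R).
    apply: (measurability _ (RGenOInfty.measurableE R)) => _ [_ [a ->] <-].
    rewrite setTI; apply: sub_sigma_algebra; apply: coord_open.
    exact: interval_open.
  by move=> A [B mB <-]; exact: mc.
- apply: smallest_sub; first exact: sigma_algebra_measurable.
  move=> U /= oU.
  pose B (p : 'rV[rat]_d * rat) : set V :=
    [set x | forall i, `|(ratr (p.1 ord0 i) : R) - x ord0 i| < ratr p.2].
  have mB p : measurable (B p).
    rewrite (_ : B p = \bigcap_(i in [set: 'I_d])
        ((@rV_coord R d i) @^-1` ball (ratr (p.1 ord0 i) : R) (ratr p.2)));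
      last first.
      by apply/seteqP; split => x /= H i; [move=> _|]; apply: H.
    apply: fin_bigcap_measurable => // i _.
    rewrite -[X in measurable X]setTI; apply: measurable_rV_coord => //.
    exact: measurable_ball.
  have -> : U = \bigcup_(p in [set p | B p `<=` U]) B p.
    apply/seteqP; split => [x Ux|x [p pU]]; last exact: pU.
    have /nbhs_ballP[e /= e0 eU] := open_nbhs_nbhs (conj oU Ux).
    have /rat_in_itvoo[q] : 0 < e / 2 by rewrite divr_gt0.
    rewrite in_itv/= => /andP[q0 qe].
    have /choice[c cP] i : exists c : rat, `|(ratr c : R) - x ord0 i| < ratr q.
      have /rat_in_itvoo[c] : x ord0 i - ratr q < x ord0 i + ratr q.
        by rewrite ltrBlDr -addrA ltrDl addr_gt0.
      by rewrite in_itv/= => cP; exists c; rewrite ltr_distl.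
    exists ((\row_i c i), q) => /=; last by move=> i; rewrite mxE.
    move=> y /= yB; apply: eU; split => // i j.
    rewrite ord1 /ball/=; have := yB j; have := cP j.
    rewrite mxE distrC => h1 h2.
    rewrite -(subrKA (ratr (c j))) (le_lt_trans (ler_normD _ _))//.
    by rewrite (splitr e) ltrD// (lt_trans _ qe).
  rewrite bigcup_mkcond; apply: countable_bigcupT_measurable => // p.
  by case: ifPn => // _; exact: mB.
Qed.

End measurable_rV_open.

(* Lebesgue measure on R^d, by iterating the product R * R^d -> R^(d+1) from
   the unit mass on R^0. *)
Section lebesgue_rV.
Context (R : realType).

Definition rV_cons (n : nat) (p : R * 'rV[R]_n) : 'rV[R]_n.+1 :=
  \row_i (if unlift ord0 i is Some j then p.2 ord0 j else p.1).

Definition rV_uncons (n : nat) (x : 'rV[R]_n.+1) : R * 'rV[R]_n :=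
  (x ord0 ord0, \row_j x ord0 (lift ord0 j)).

Lemma rV_consK n : cancel (@rV_cons n) (@rV_uncons n).
Proof.
move=> [a v]; congr (_, _); first by rewrite mxE unlift_none.
by apply/rowP => j; rewrite !mxE liftK.
Qed.

Lemma rV_unconsK n : cancel (@rV_uncons n) (@rV_cons n).
Proof.
move=> x; apply/rowP => i; rewrite mxE /=.
by case: unliftP => [j ->|->] //=; rewrite mxE.
Qed.

Lemma measurable_rV_cons n : measurable_fun [set: R * 'rV[R]_n] (@rV_cons n).
Proof.
apply/measurable_fun_rVP => i; under eq_fun do rewrite mxE.
case: (unlift ord0 i) => [j|]; last exact: measurable_fst.
exact: (measurableT_comp (measurable_rV_coord j) measurable_snd).
Qed.

Lemma measurable_rV_uncons n :
  measurable_fun [set: 'rV[R]_n.+1] (@rV_uncons n).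
Proof.
apply/measurable_fun_pairP; split; first exact: (measurable_rV_coord ord0).
apply/measurable_fun_rVP => j; under eq_fun do rewrite mxE.
exact: measurable_rV_coord.
Qed.

Section step.
Context (n : nat) (m : {sigma_finite_measure set 'rV[R]_n -> \bar R}).

Definition lebesgue_rVS : set 'rV[R]_n.+1 -> \bar R :=
  pushforward (lebesgue_measure \x m)%E (@rV_cons n).

Let lebesgue_rVS0 : lebesgue_rVS set0 = 0%E.
Proof. by rewrite /lebesgue_rVS /pushforward preimage_set0 measure0. Qed.

Let lebesgue_rVS_ge0 A : (0 <= lebesgue_rVS A)%E.
Proof. by rewrite /lebesgue_rVS /pushforward. Qed.

Let lebesgue_rVS_sigma_additive : semi_sigma_additive lebesgue_rVS.
Proof.
move=> F mF tF mUF; rewrite /lebesgue_rVS /pushforward preimage_bigcup.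
apply: measure_semi_sigma_additive.
- move=> k; rewrite -[X in measurable X]setTI.
  exact: (measurable_rV_cons _ (mF k)).
- apply/trivIsetP => /= i j _ _ ij; rewrite -preimage_setI.
  by move/trivIsetP : tF => /(_ _ _ _ _ ij) ->//; rewrite preimage_set0.
- rewrite -preimage_bigcup -[X in measurable X]setTI.
  exact: (measurable_rV_cons _ mUF).
Qed.

HB.instance Definition _ := isMeasure.Build _ _ _ lebesgue_rVS
  lebesgue_rVS0 lebesgue_rVS_ge0 lebesgue_rVS_sigma_additive.

Let lebesgue_rVS_sigma_finite : sigma_finite setT lebesgue_rVS.
Proof.
have /sigma_finiteP[F [TF ndF Foo]] := sigma_finiteT (@lebesgue_measure R).
have /sigma_finiteP[G [TG ndG Goo]] := sigma_finiteT m.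
exists (fun k => @rV_uncons n @^-1` (F k `*` G k)).
  rewrite -preimage_bigcup (_ : \bigcup_k _ = setT) ?preimage_setT//.
  apply/seteqP; split => // -[a v] _.
  have [k _ Fka] : (\bigcup_k F k) a by rewrite -TF.
  have [l _ Glv] : (\bigcup_k G k) v by rewrite -TG.
  exists (maxn k l) => //; split.
    by move: a Fka; exact/subsetPset/ndF/leq_maxl.
  by move: v Glv; exact/subsetPset/ndG/leq_maxr.
move=> k; have [mF Fk] := Foo k; have [mG Gk] := Goo k.
have mFG : measurable (F k `*` G k : set (R * 'rV[R]_n)) by exact: measurableX.
split.
  by rewrite -[X in measurable X]setTI; exact: measurable_rV_uncons.
rewrite /lebesgue_rVS /pushforward.
rewrite -comp_preimage (_ : _ \o _ = id); last exact/funext/rV_consK.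
by rewrite preimage_id product_measure1E// lte_mul_pinfty// ge0_fin_numE.
Qed.

HB.instance Definition _ := Measure_isSigmaFinite.Build _ _ _ lebesgue_rVS
  lebesgue_rVS_sigma_finite.

End step.

Fixpoint lebesgue_rV (n : nat) :
    {sigma_finite_measure set 'rV[R]_n -> \bar R} :=
  if n is k.+1 then lebesgue_rVS (lebesgue_rV k) else \d_(0 : 'rV[R]_0).

Lemma lebesgue_rV_box n (A : 'I_n -> set R) :
  (forall i, measurable (A i)) ->
  lebesgue_rV n [set x | forall i, A i (x ord0 i)] =
  (\prod_(i < n) lebesgue_measure (A i))%E.
Proof.
elim: n A => [|n IH] A mA.
  rewrite big_ord0 /= diracE mem_set//= => -[] //.
have mB :
  measurable [set x : 'rV[R]_n | forall i, A (lift ord0 i) (x ord0 i)].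
  rewrite (_ : [set x | _] = \bigcap_(i in [set: 'I_n])
      ((@rV_coord R n i) @^-1` A (lift ord0 i))); last first.
    by apply/seteqP; split => x /= H i; [move=> _|]; apply: H.
  apply: fin_bigcap_measurable => // i _.
  by rewrite -[X in measurable X]setTI; apply: measurable_rV_coord.
rewrite big_ord_recl -(IH (A \o lift ord0)); last by move=> i; exact: mA.
rewrite -product_measure1E//=; last exact: mA.
rewrite /lebesgue_rVS /pushforward.
congr product_measure1; apply/seteqP; split => -[a v] /=.
  move=> H; split; first by have := H ord0; rewrite mxE unlift_none.
  by move=> i; have := H (lift ord0 i); rewrite mxE liftK.
by move=> [H0 H] i; rewrite mxE; case: unliftP => [j ->|->].
Qed.

End lebesgue_rV.

(* The canonical norm of ['rV[R]_d] in MathComp-Analysis is the sup norm, so the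
   Euclidean notions are defined separately. *)
Section euclidean.
Context (R : realType) (d : nat).
Implicit Types x y : 'rV[R]_d.

Definition enorm x : R := Num.sqrt (\sum_(i < d) x ord0 i ^+ 2).

Definition eball x (r : R) : set 'rV[R]_d := [set z | enorm (z - x) < r].

Definition euclidean_contraction (T : 'rV[R]_d -> 'rV[R]_d) : Prop :=
  forall x y, enorm (T x - T y) <= enorm (x - y).

End euclidean.

Definition kneser_poulsen_intersection (R : realType) (d : nat) : Prop :=
  forall (m : nat) (r : R) (x y : 'I_m -> 'rV[R]_d),
    (1 <= m)%N -> 0 < r ->
    (forall i j, enorm (y i - y j) <= enorm (x i - x j)) ->
    (lebesgue_rV R d (\bigcap_i eball (x i) r) <=
     lebesgue_rV R d (\bigcap_i eball (y i) r))%E.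

Section random_vectors.
Context (R : realType) (d : nat) (dO : measure_display)
  (Omega : measurableType dO) (P : probability Omega R).
Local Open Scope ereal_scope.

Definition is_density (Y : Omega -> 'rV[R]_d) (f : 'rV[R]_d -> R) : Prop :=
  [/\ measurable_fun setT f, (forall x, 0 <= f x)%R &
      forall A, measurable A ->
        P (Y @^-1` A) = \int[lebesgue_rV R d]_(x in A) (f x)%:E].

(* A chosen density of [Y]; the choice is immaterial for what follows, by
   [renyi_entropyE]. Junk value [0] when [Y] has no density. *)
Definition density (Y : Omega -> 'rV[R]_d) : 'rV[R]_d -> R :=
  xget (fun _ => 0%R) [set f | is_density Y f].

Definition renyi_entropy (alpha : R) (Y : Omega -> 'rV[R]_d) : \bar R :=
  ((1 - alpha)^-1)%:E *
  lne (\int[lebesgue_rV R d]_x (density Y x `^ alpha)%:E).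

Definition uniform_on (D : set 'rV[R]_d) (W : Omega -> 'rV[R]_d) : Prop :=
  forall A, measurable A ->
    P (W @^-1` A) =
    lebesgue_rV R d (A `&` D) * ((fine (lebesgue_rV R d D))^-1)%:E.

Definition independent (X Y : Omega -> 'rV[R]_d) : Prop :=
  forall A B, measurable A -> measurable B ->
    P (X @^-1` A `&` Y @^-1` B) = P (X @^-1` A) * P (Y @^-1` B).

Lemma density_unique (Y : Omega -> 'rV[R]_d) f g :
  is_density Y f -> is_density Y g ->
  ae_eq (lebesgue_rV R d) setT (EFin \o f) (EFin \o g).
Proof.
move=> [mf f0 fP] [mg g0 gP]; apply: integral_ae_eq => //.
- apply/integrableP; split; first exact/measurable_EFinP.
  under eq_integral do rewrite /= ger0_norm//.
  by rewrite -fP// preimage_setT probability_setT ltry.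
- exact/measurable_EFinP.
- by move=> A _ mA; rewrite -fP// -gP.
Qed.

Lemma renyi_entropyE (alpha : R) (Y : Omega -> 'rV[R]_d) f :
  is_density Y f ->
  renyi_entropy alpha Y =
  ((1 - alpha)^-1)%:E * lne (\int[lebesgue_rV R d]_x (f x `^ alpha)%:E).
Proof.
move=> fY; rewrite /renyi_entropy; congr (_ * lne _).
have dY : is_density Y (density Y).
  by rewrite /density; case: xgetP => [g ->//|/(_ f)].
have mpow h : is_density Y h ->
    measurable_fun setT (fun x => (h x `^ alpha)%:E).
  case=> mh _ _; apply/measurable_EFinP.
  exact: (measurableT_comp (measurable_powR alpha) mh).
apply: ae_eq_integral => //; [exact: mpow|exact: mpow|].
apply: filterS (density_unique dY fY) => x /= /(_ I) [xE] _.
by rewrite xE.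
Qed.

End random_vectors.

(* Main.v *)
(* The density of [X + W] at [z] is [c * p z], where [p z] is the probability
   that [X] lies in the unit ball about [z] and [c] is the inverse volume of
   that ball. By Tonelli, the integral of [p ^+ k] is the expected volume of the
   intersection of the unit balls about [k] independent copies of [X], and by
   hypothesis applying [T] to the centres can only increase that volume. For
   [k >= 2] the entropy is a decreasing function of the integral of the [k]-th
   power of the density. *)
From HB Require Import structures.
Require Import Defs.
From mathcomp Require Import all_boot all_order all_algebra.
From mathcomp Require Import all_classical all_reals all_analysis.
From mathcomp Require Import measurable_realfun.

Set Implicit Arguments.
Unset Strict Implicit.
Unset Printing Implicit Defensive.

Import Order.TTheory GRing.Theory Num.Theory.
Import numFieldNormedType.Exports.

Local Open Scope classical_set_scope.
Local Open Scope ring_scope.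

(** * Sign reversal in the extended reals; translation invariance of Lebesgue measure *)

Lemma lee_wnmul2l (R : realType) (a : R) (x y : \bar R) :
  a <= 0 -> (x <= y)%E -> (a%:E * y <= a%:E * x)%E.
Proof.
move=> a0 xy; rewrite -(opprK a) EFinN !mulNe leeN2.
by apply: lee_wpmul2l => //; rewrite lee_fin oppr_ge0.
Qed.

Lemma lebesgue_measure_translate (R : realType) (a : R) (A : set R) :
  measurable A ->
  lebesgue_measure ((fun x => a + x) @^-1` A) = lebesgue_measure A.
Proof.
move=> mA; pose t (x : R) : measurableTypeR R := a + x.
rewrite -[LHS]/(pushforward lebesgue_measure t A).
apply/esym/lebesgue_measure_unique => //=; first exact: measurable_funD.
move=> mt _ [[u v] _ <-]; rewrite /pushforward.
have -> : t @^-1` `]u, v] = `]u - a, v - a]%classic.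
  apply/seteqP; split => x /=; rewrite !in_itv/= ltrBlDl lerBrDl//.
rewrite !lebesgue_measure_itv/= !lte_fin ltrD2r.
by case: ifP => // _; rewrite -!EFinB opprB addrA subrK.
Qed.

Section translation.
Context (R : realType).

Lemma measurable_translate_rV d (v : 'rV[R]_d) :
  measurable_fun [set: 'rV[R]_d] (fun x => v + x).
Proof.
apply/measurable_fun_rVP => i; under eq_fun do rewrite mxE.
by apply: measurable_funD => //; exact: measurable_rV_coord.
Qed.

(** By induction on [d]: through [rV_cons], translation by [v] acts separately on the first
    coordinate and on the tail. Its pushforward therefore agrees with the product measure on
    rectangles, which determine that measure. *)
Lemma lebesgue_rV_translate d (v : 'rV[R]_d) (A : set 'rV[R]_d) :
  measurable A ->
  lebesgue_rV R d ((fun x => v + x) @^-1` A) = lebesgue_rV R d A.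
Proof.
elim: d v A => [|d IH] v A mA.
  congr (lebesgue_rV R 0 _); apply/seteqP; split => x /=;
    by rewrite [v + x]thinmx0 [x]thinmx0.
rewrite /= /lebesgue_rVS /pushforward.
pose t (p : measurableTypeR R * 'rV[R]_d) : measurableTypeR R * 'rV[R]_d :=
  ((rV_uncons v).1 + p.1, (rV_uncons v).2 + p.2).
have mt : measurable_fun setT t.
  apply/measurable_fun_pairP; split => /=.
    apply: measurable_funD => //; exact: measurable_fst.
  exact: (measurableT_comp (measurable_translate_rV _) measurable_snd).
have mcA : measurable (@rV_cons R d @^-1` A).
  by rewrite -[X in measurable X]setTI; exact: measurable_rV_cons.
have -> : @rV_cons R d @^-1` ((fun x => v + x) @^-1` A) =
    t @^-1` (@rV_cons R d @^-1` A).
  apply/funext => -[a x]; congr (A _); apply/rowP => i.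
  by rewrite !mxE/=; case: unliftP => [j ->|->] /=; rewrite ?mxE.
rewrite -[LHS]/(pushforward (lebesgue_measure \x lebesgue_rV R d)%E t _).
apply/esym/product_measure_unique => // B C mB mC /=.
rewrite /pushforward -(lebesgue_measure_translate (rV_uncons v).1)//.
rewrite -(IH (rV_uncons v).2)// -product_measure1E//.
  rewrite -[X in measurable X]setTI; exact: measurable_funD.
by rewrite -[X in measurable X]setTI; exact: measurable_translate_rV.
Qed.

End translation.

(** * Tonelli's theorem on sections of a measurable set *)

Section section_integrals.
Context d1 d2 (T1 : measurableType d1) (T2 : measurableType d2) (R : realType).
Context (P : probability T1 R) (m : {sigma_finite_measure set T2 -> \bar R}).
Context (E : set (T1 * T2)) (mE : measurable E).
Local Notation p z := (fine (P (ysection E z))).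

Lemma measurable_fine_ysection : measurable_fun [set: T2] (fun z => p z).
Proof. exact: (measurableT_comp _ (measurable_fun_ysection P mE)). Qed.

Section xsection_integral.
Context (D : set T2) (mD : measurable D).
Context (g : T2 -> R) (mg : measurable_fun setT g) (g0 : forall z, 0 <= g z).
(** [D] and [E] enter as indicators, so that Tonelli applies on the whole product space. *)
Let F (q : T1 * T2) := (g q.2 * \1_D q.2 * \1_E q)%:E.

Let F0 q : (0 <= F q)%E. Proof. by rewrite lee_fin !mulr_ge0. Qed.

Let mF : measurable_fun setT F.
Proof.
apply/measurable_EFinP/measurable_funM; last exact: measurable_indic.
apply: measurable_funM; first exact: (measurableT_comp mg measurable_snd).
exact: (measurableT_comp (measurable_indic mD) measurable_snd).
Qed.

Let integralF w :
  (\int[m]_(z in D `&` xsection E w) (g z)%:E = \int[m]_z F (w, z))%E.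
Proof.
rewrite [LHS]integral_mkcond; apply: eq_integral => z _.
rewrite /F /= /patch in_setI mem_xsection !indicE.
by case: (z \in D); case: (_ \in E); rewrite ?(mulr1,mulr0).
Qed.

Lemma measurable_integral_xsection :
  measurable_fun setT
    (fun w => \int[m]_(z in D `&` xsection E w) (g z)%:E)%E.
Proof.
under eq_fun do rewrite integralF.
exact: measurable_fun_fubini_tonelli_F.
Qed.

(** The factor [p z] is itself an integral over [w]; exchanging the integrals trades it for
    restricting [z] to the section of [E] at [w]. When [E] is a graph of unit balls, that section is
    one more ball. *)
Lemma integral_ysectionM :
  (\int[m]_(z in D) (g z * p z)%:E =
   \int[P]_w \int[m]_(z in D `&` xsection E w) (g z)%:E)%E.
Proof.
under [RHS]eq_integral do rewrite integralF.
rewrite (fubini_tonelli _ mF)//.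
rewrite [LHS]integral_mkcond; apply: eq_integral => z _.
under eq_integral do rewrite /F /= EFinM.
rewrite ge0_integralZl//=; last 2 first.
- apply/measurable_EFinP/(measurableT_comp (measurable_indic mE)).
  exact: pair2_measurable.
- by rewrite lee_fin mulr_ge0.
have -> : (\int[P]_w (\1_E (w, z))%:E = (p z)%:E)%E.
  rewrite fineK ?fin_num_measure//; last exact: measurable_ysection.
  rewrite -[X in _ = P X]setIT -integral_indic//;
    last exact: measurable_ysection.
  by apply: eq_integral => w _; rewrite !indicE mem_ysection.
by rewrite /patch indicE; case: (z \in D); rewrite ?mulr1 ?mulr0 ?mul0e.
Qed.

End xsection_integral.

End section_integrals.

(** * The Euclidean norm and measurability of contractions *)

Section euclidean_norm.
Context (R : realType) (d : nat).
Implicit Types x y : 'rV[R]_d.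

Lemma le_coord_enorm x i : `|x ord0 i| <= enorm x.
Proof.
rewrite -sqrtr_sqr ler_wsqrtr// (bigD1 i)//= lerDl.
by apply: sumr_ge0 => j _; exact: sqr_ge0.
Qed.

Lemma enorm0 : enorm (0 : 'rV[R]_d) = 0.
Proof.
by rewrite /enorm big1 ?sqrtr0// => i _; rewrite mxE expr0n.
Qed.

Lemma continuous_enormB x : continuous (fun y => enorm (x - y)).
Proof.
move=> y; apply: (@continuous_comp _ _ _ _ Num.sqrt);
  last exact: sqrt_continuous.
have := @continuous_big R 'I_d +%R 0 xpredT (@add_continuous _) 'rV[R]_d
  (index_enum 'I_d) (fun i y => (x - y) ord0 i ^+ 2).
apply => i _ {}y; under eq_fun do rewrite !mxE.
apply: (@continuous_comp _ _ _ (fun y : 'rV[R]_d => x ord0 i - y ord0 i)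
  (fun a => a ^+ 2)); last exact: exprn_continuous.
apply: continuousB; [exact: cst_continuous|exact: coord_continuous].
Qed.

(** [T] is continuous for the sup-norm topology, because the Euclidean norm is continuous there and
    dominates every coordinate; open sets generate the sigma-algebra. *)
Lemma euclidean_contraction_measurable (T : 'rV[R]_d -> 'rV[R]_d) :
  euclidean_contraction T -> measurable_fun setT T.
Proof.
move=> cT; have oT U : open U -> open (T @^-1` U).
  rewrite !openE => oU x /oU /nbhs_ballP[e /= e0 eU].
  have /cvgr_lt : enorm (x - y) @[y --> x] --> enorm (x - x).
    exact: continuous_enormB.
  rewrite subrr enorm0 => /(_ e e0).
  apply: filterS => y xye; apply: eU; split => // i j.
  rewrite ord1 /ball/=; have := le_coord_enorm (T x - T y) j.
  rewrite !mxE => /le_lt_trans; apply.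
  exact: le_lt_trans (cT x y) xye.
apply: (measurability _ (@measurable_rV_open R d)) => _ [U oU <-].
rewrite setTI measurable_rV_open; apply: sub_sigma_algebra; exact: oT.
Qed.

End euclidean_norm.

(** * The density of a sum with uniform noise on the unit ball *)

Section smoothing.
Context (R : realType) (d : nat) (dO : measure_display)
  (Omega : measurableType dO) (P : probability Omega R).
Implicit Types S W : Omega -> 'rV[R]_d.

(** One measurable set for both orders of integration: its [xsection] at [w] is the unit ball about
    [S w], its [ysection] at [z] the event that [S] lies in the unit ball about [z]. *)
Definition unit_ball_graph S : set (Omega * 'rV[R]_d) :=
  [set q | eball (S q.1) 1 q.2].

Lemma measurable_enorm : measurable_fun setT (@enorm R d).
Proof.
apply: (measurableT_comp (continuous_measurable_fun (@sqrt_continuous R))).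
apply: measurable_sum => i; apply: measurable_funX.
exact: measurable_rV_coord.
Qed.

Lemma measurable_unit_ball_graph S :
  measurable_fun setT S -> measurable (unit_ball_graph S).
Proof.
move=> mS; rewrite (_ : unit_ball_graph S =
  (fun q => enorm (q.2 - S q.1)) @^-1` [set` `]-oo, 1[]); last first.
  by apply/seteqP; split => q /=; rewrite in_itv.
rewrite -[X in measurable X]setTI.
apply: (measurableT_comp measurable_enorm) => //.
apply/measurable_fun_rVP => i; under eq_fun do rewrite !mxE.
apply: measurable_funB.
  exact: (measurableT_comp (measurable_rV_coord i) measurable_snd).
apply: (measurableT_comp (measurable_rV_coord i)).
exact: (measurableT_comp mS measurable_fst).
Qed.

Lemma measurable_eball (x : 'rV[R]_d) r : measurable (eball x r).
Proof.
rewrite (_ : eball x r = (fun z => enorm (z - x)) @^-1` [set` `]-oo, r[]).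
  rewrite -[X in measurable X]setTI.
  apply: (measurableT_comp measurable_enorm) => //.
  apply/measurable_fun_rVP => i; under eq_fun do rewrite !mxE.
  by apply: measurable_funB => //; exact: measurable_rV_coord.
by apply/seteqP; split => q /=; rewrite in_itv.
Qed.

Lemma xsection_unit_ball_graph S w :
  xsection (unit_ball_graph S) w = eball (S w) 1.
Proof. by apply/seteqP; split => z; rewrite /xsection/= inE. Qed.

Definition ball_prob S (z : 'rV[R]_d) : R :=
  fine (P (ysection (unit_ball_graph S) z)).

Lemma ball_prob_ge0 S z : 0 <= ball_prob S z.
Proof. exact: fine_ge0. Qed.

(** Independence makes the joint law agree with the product of the marginal laws on rectangles,
    hence everywhere. The integral against the law of [S] is then pulled back to [Omega]. *)
Lemma independent_joint_law S W (A : set ('rV[R]_d * 'rV[R]_d)) :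
  measurable_fun setT S -> measurable_fun setT W -> independent P S W ->
  measurable A ->
  P ((fun w => (S w, W w)) @^-1` A) =
  (\int[P]_w P (W @^-1` xsection A (S w)))%E.
Proof.
move=> mS mW SW mA.
pose Sf : {mfun Omega >-> 'rV[R]_d} :=
  HB.pack S (isMeasurableFun.Build _ _ _ _ _ mS).
pose Wf : {mfun Omega >-> 'rV[R]_d} :=
  HB.pack W (isMeasurableFun.Build _ _ _ _ _ mW).
have mSW : measurable_fun setT (fun w => (S w, W w)).
  by apply/measurable_fun_pairP; split.
transitivity ((distribution P Sf \x distribution P Wf)%E A).
  rewrite -[LHS]/(pushforward P (fun w => (S w, W w)) A).
  by apply/esym/product_measure_unique => // B C; exact: SW.
rewrite -[LHS]/(\int[pushforward P S]_x distribution P Wf (xsection A x))%E.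
rewrite ge0_integral_pushforward//.
exact: measurable_fun_xsection.
Qed.

(** Given [S w], the sum is uniform on the unit ball about [S w], so it hits [A] with probability
    [c] times the volume of [A] inside that ball. Averaging over [w] and exchanging the integrals
    produces [ball_prob]. *)
Lemma density_smoothing S W :
  measurable_fun setT S -> measurable_fun setT W ->
  uniform_on P (eball 0 1) W -> independent P S W ->
  is_density P (fun w => S w + W w)
    (fun z => (fine (lebesgue_rV R d (eball 0 1)))^-1 * ball_prob S z).
Proof.
move=> mS mW uW SW; set c := (fine _)^-1.
have c0 : 0 <= c by rewrite invr_ge0 fine_ge0.
have mE := measurable_unit_ball_graph mS.
have mp : measurable_fun setT (ball_prob S).
  exact: measurable_fine_ysection.
split.
- exact: measurable_funM.
- by move=> z; rewrite mulr_ge0 ?ball_prob_ge0.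
move=> A mA.
pose B : set ('rV[R]_d * 'rV[R]_d) := (fun q => q.1 + q.2) @^-1` A.
have mB : measurable B.
  rewrite -[X in measurable X]setTI.
  suff : measurable_fun setT (fun q : 'rV[R]_d * 'rV[R]_d => q.1 + q.2).
    by exact.
  apply/measurable_fun_rVP => i; under eq_fun do rewrite !mxE.
  by apply: measurable_funD; apply: (measurableT_comp (measurable_rV_coord i)).
rewrite -[LHS]/(P ((fun w => (S w, W w)) @^-1` B)) independent_joint_law//.
transitivity (\int[P]_w (c%:E * lebesgue_rV R d (A `&` eball (S w) 1)))%E.
  apply: eq_integral => w _; rewrite uW; last exact: measurable_xsection.
  (* Pulled back along translation by [S w], the part of [A] in the ball about [S w] becomes the
     section of [B] cut with the ball about the origin. *)
  rewrite muleC -[in RHS](lebesgue_rV_translate (S w)).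
    congr (_ * _)%E; congr (lebesgue_rV R d _); apply/seteqP.
    by split => x;
      rewrite /xsection /eball/= inE subr0 [_ - S w]addrAC subrr add0r.
  by apply: measurableI => //; exact: measurable_eball.
under [RHS]eq_integral do rewrite EFinM.
rewrite [RHS]ge0_integralZl//; first last.
- by move=> z _; rewrite lee_fin ball_prob_ge0.
- by apply/measurable_EFinP; exact: measurable_funTS.
(* Volumes become integrals of the constant 1, to match [integral_ysectionM] with [g = 1]. *)
have cE w : (lebesgue_rV R d (A `&` eball (S w) 1) =
    \int[lebesgue_rV R d]_(z in A `&` xsection (unit_ball_graph S) w) 1)%E.
  rewrite integral_cst ?mul1e ?xsection_unit_ball_graph//.
  by apply: measurableI => //; exact: measurable_eball.
rewrite ge0_integralZl//; last first.
  under eq_fun do rewrite cE.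
  exact: (@measurable_integral_xsection _ _ _ _ _ _ _ mE A mA (cst 1)).
congr (_ * _)%E; under eq_integral do rewrite cE.
have /= <- := @integral_ysectionM _ _ _ _ _ P (lebesgue_rV R d) _ mE A mA
  (cst 1) (measurable_cst _) (fun=> ler01).
by apply: eq_integral => z _; rewrite mul1r.
Qed.

End smoothing.

(** * From intersections of balls to powers of ball probabilities *)

Lemma kneser_poulsen_seq (R : realType) (d : nat)
    (T : 'rV[R]_d -> 'rV[R]_d) (s : seq 'rV[R]_d) :
  kneser_poulsen_intersection R d -> euclidean_contraction T ->
  (0 < size s)%N ->
  (lebesgue_rV R d (\bigcap_(x in [set` s]) eball x 1) <=
   lebesgue_rV R d (\bigcap_(x in [set` s]) eball (T x) 1))%E.
Proof.
move=> KP cT s0.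
(* Balls are reindexed by positions in [s], so a repeated point is simply a repeated centre. *)
have eqI (S : 'rV[R]_d -> 'rV[R]_d) : \bigcap_(x in [set` s]) eball (S x) 1 =
    \bigcap_(i : 'I_(size s)) eball (S s`_i) 1.
  apply/seteqP; split => z Hz.
    by move=> i _; apply: Hz => /=; exact: mem_nth.
  move=> x /= xs; rewrite -(nth_index 0 xs).
  have xs' : (index x s < size s)%N by rewrite index_mem.
  exact: (Hz (Ordinal xs')).
rewrite (eqI id) eqI.
exact: (KP _ 1 (fun i : 'I_(size s) => s`_i) (fun i => T s`_i)).
Qed.

Section contraction.
Context (R : realType) (d : nat) (dO : measure_display)
  (Omega : measurableType dO) (P : probability Omega R).
Context (KP : kneser_poulsen_intersection R d).
Context (T : 'rV[R]_d -> 'rV[R]_d) (cT : euclidean_contraction T).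
Context (X : Omega -> 'rV[R]_d) (mX : measurable_fun setT X).

(* The centres [s] are the points already integrated out: each step of the
   induction trades one factor of the power for one more ball. *)
Lemma integral_ball_prob_contraction (s : seq 'rV[R]_d) j :
  (0 < size s + j)%N ->
  (\int[lebesgue_rV R d]_(z in \bigcap_(x in [set` s]) eball x 1)
     (ball_prob P X z ^+ j)%:E <=
   \int[lebesgue_rV R d]_(z in \bigcap_(x in [set` s]) eball (T x) 1)
     (ball_prob P (T \o X) z ^+ j)%:E)%E.
Proof.
have mTX : measurable_fun setT (T \o X).
  exact: measurableT_comp (euclidean_contraction_measurable cT) mX.
have mI (S : 'rV[R]_d -> 'rV[R]_d) (u : seq 'rV[R]_d) :
    measurable (\bigcap_(x in [set` u]) eball (S x) 1).
  by apply: fin_bigcap_measurable => // x _; exact: measurable_eball.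
have consI (S : 'rV[R]_d -> 'rV[R]_d) x u :
    \bigcap_(y in [set` x :: u]) eball (S y) 1 =
    \bigcap_(y in [set` u]) eball (S y) 1 `&` eball (S x) 1.
  apply/seteqP; split => z Hz.
    by split => [y yu|]; apply: Hz; rewrite /= inE ?eqxx ?yu ?orbT.
  by move=> y; rewrite /= inE => /predU1P[->|]; [exact: Hz.2|exact: Hz.1].
elim: j s => [|j IH] s sj.
  (* With no factor left, both sides are volumes of intersections; [s] is nonempty since
     [size s + 0] is positive. *)
  under eq_integral do rewrite expr0.
  under [leRHS]eq_integral do rewrite expr0.
  rewrite !integral_cst ?mul1e//.
  by apply: kneser_poulsen_seq => //; rewrite addn0 in sj.
have mp (S : Omega -> 'rV[R]_d) : measurable_fun setT S ->
    measurable_fun setT (fun z => ball_prob P S z ^+ j).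
  move=> mS; apply: measurable_funX.
  exact: measurable_fine_ysection (measurable_unit_ball_graph mS).
have p0 (S : Omega -> 'rV[R]_d) z : 0 <= ball_prob P S z ^+ j.
  by rewrite exprn_ge0 ?ball_prob_ge0.
(* One factor is split off to be traded; the remaining [j]-th power is the weight [g]. *)
under eq_integral do rewrite exprSr.
under [leRHS]eq_integral do rewrite exprSr.
have mE := @measurable_unit_ball_graph R d dO Omega.
have -> := @integral_ysectionM _ _ _ _ _ P (lebesgue_rV R d) _ (mE _ mX) _
  (mI id s) _ (mp _ mX) (p0 X).
have -> := @integral_ysectionM _ _ _ _ _ P (lebesgue_rV R d) _ (mE _ mTX) _
  (mI T s) _ (mp _ mTX) (p0 (T \o X)).
apply: ge0_le_integral; first exact: measurableT.
- by move=> w _; apply: integral_ge0 => z _; rewrite lee_fin p0.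
- exact: (measurable_integral_xsection _ (mE _ mX) (mI id s) (mp _ mX)).
- exact: (measurable_integral_xsection _ (mE _ mTX) (mI T s) (mp _ mTX)).
(* For each fixed [w], the new centres are [X w] and its image [T (X w)], so the induction
   hypothesis applies to [X w :: s]. *)
move=> w _; rewrite !xsection_unit_ball_graph -(consI id) -consI.
by apply: IH; rewrite addSn.
Qed.

End contraction.

(** * Comparison of the entropies *)

Theorem proposition1p1 (R : realType) (d : nat) :
  (1 <= d)%N ->
  kneser_poulsen_intersection R d ->
  forall (dO : measure_display) (Omega : measurableType dO)
    (P : probability Omega R) (X W : {RV P >-> 'rV[R]_d})
    (T : 'rV[R]_d -> 'rV[R]_d) (k : nat),
    euclidean_contraction T ->
    (2 <= k)%N ->
    uniform_on P (eball 0 1) W ->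
    independent P X W ->
    (renyi_entropy P k%:R (fun w => (T (X w) + W w)%R) <=
     renyi_entropy P k%:R (fun w => (X w + W w)%R))%E.
Proof.
move=> _ KP dO Omega P X W T k cT k2 uW XW.
have mX : measurable_fun setT X by [].
have mT := euclidean_contraction_measurable cT.
have mTX : measurable_fun setT (T \o X) by exact: measurableT_comp mT mX.
have TXW : independent P (T \o X) W.
  move=> A B mA mB; rewrite comp_preimage XW//.
  by rewrite -[X in measurable X]setTI; exact: mT.
have mW : measurable_fun setT W by [].
rewrite (renyi_entropyE _ (density_smoothing mX mW uW XW)).
rewrite (renyi_entropyE _ (density_smoothing mTX mW uW TXW)).
set c := (fine _)^-1.
have c0 : 0 <= c by rewrite invr_ge0 fine_ge0.
have int_pow (S : Omega -> 'rV[R]_d) : measurable_fun setT S ->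
    (\int[lebesgue_rV R d]_z ((c * ball_prob P S z) `^ k%:R)%:E =
    (c ^+ k)%:E * \int[lebesgue_rV R d]_z (ball_prob P S z ^+ k)%:E)%E.
  move=> mS; rewrite -ge0_integralZl//.
  - apply: eq_integral => z _.
    by rewrite powR_mulrn ?mulr_ge0 ?ball_prob_ge0// exprMn EFinM.
  - apply/measurable_EFinP/measurable_funX.
    by apply: measurable_fine_ysection; exact: measurable_unit_ball_graph.
  - by move=> z _; rewrite lee_fin exprn_ge0 ?ball_prob_ge0.
  - by rewrite lee_fin exprn_ge0.
apply: lee_wnmul2l; first by rewrite invr_le0 subr_le0 ler1n ltnW.
(* [lne] is compared on the closed interval from 0 to [+oo], which covers integrals that vanish or
   diverge. *)
rewrite lee_lne ?in_itv/= ?leey ?andbT.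
- rewrite [leLHS](int_pow _ mX) [leRHS](int_pow _ mTX).
  apply: lee_wpmul2l; first by rewrite lee_fin exprn_ge0.
  (* With no centres yet, both intersections are the whole space. *)
  have := @integral_ball_prob_contraction _ _ _ _ P KP _ cT _ mX [::] k.
  by rewrite set_nil !bigcap_set0; apply; exact: ltnW.
- by apply: integral_ge0 => z _; rewrite lee_fin powR_ge0.
- by apply: integral_ge0 => z _; rewrite lee_fin powR_ge0.
Qed.
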